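(* Let $\{x_n\}_{n\ge 1}$ be a sequence of real numbers such that the sequence $\{\Delta^2 x_n\}_{n\ge1}$ is weakly-monotonic and $$\Delta^2 x_n\to 0,\qquad |n^2\Delta^2 x_n|\to\infty\quad\text{as } n\to\infty.$$ Then $\{x_n\}$ is uniformly distributed modulo 1.
   Context: Differences: $\Delta x_n=x_{n+1}-x_n$ and $\Delta^2x_n=\Delta(\Delta x_n)=x_{n+2}-2x_{n+1}+x_n$. A sequence $\{u_n\}_{n\ge1}$ of real numbers is weakly-decreasing if $u_n\ge 0$ for all $n$ and there is a constant $\mathcal K\ge 1$ such that $u_j\le \mathcal K u_n$ whenever $j>n$ (equivalently $\max_{j>k}u_j\le \mathcal K\min_{j\le k}u_j$ for all $k=1,2,\ldots$). It is weakly-increasing if $\{-u_n\}$ is weakly-decreasing. It is weakly-monotonic if it is weakly-decreasing or weakly-increasing. A sequence $\{x_n\}$ is uniformly distributed modulo 1 if for every interval $[a,b)\subset[0,1)$, $$\lim_{N\to\infty}\frac{\#\{1\le n\le N:\ \{x_n\}\in[a,b)\}}{N}=b-a,$$ where $\{x_n\}$ inside the set denotes the fractional part of $x_n$. *)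

(* Defs.v *)
From HB Require Import structures.
From mathcomp Require Import all_boot all_order all_algebra.
From mathcomp Require Import boolp classical_sets reals topology normedtype.
From mathcomp Require Import sequences.
Set Implicit Arguments.
Unset Strict Implicit.
Unset Printing Implicit Defensive.
Import Order.TTheory GRing.Theory Num.Theory.
Import numFieldNormedType.Exports.
Local Open Scope classical_set_scope.
Local Open Scope ring_scope.

(* Sequences (u_n)_{n >= 1} are functions on [nat] whose value at index 0 is
   never used. *)

(* [telescope u n = u n.+1 - u n] is the forward difference. *)
Definition delta2 (R : zmodType) (u : nat -> R) : nat -> R :=
  telescope (telescope u).

Definition weakly_decreasing (R : realType) (u : nat -> R) : Prop :=
  (forall n, (1 <= n)%N -> 0 <= u n) /\
  exists2 K : R, 1 <= K &
    forall n j, (1 <= n)%N -> (n < j)%N -> u j <= K * u n.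

Definition weakly_increasing (R : realType) (u : nat -> R) : Prop :=
  weakly_decreasing (fun n => - u n).

Definition weakly_monotonic (R : realType) (u : nat -> R) : Prop :=
  weakly_decreasing u \/ weakly_increasing u.

Definition frac_part (R : realType) (r : R) : R := r - (Num.floor r)%:~R.

(* Division by zero at N = 0 is harmless: only the limit matters. *)
Definition uniformly_distributed_mod1 (R : realType) (x : nat -> R) : Prop :=
  forall a b : R, 0 <= a -> a < b -> b <= 1 ->
    (fun N : nat =>
       (count (fun n => a <= frac_part (x n) < b) (index_iota 1 N.+1))%:R
         / N%:R : R) @ \oo --> b - a.

(* Main.v *)
Require Import Defs.
From HB Require Import structures.
From mathcomp Require Import all_boot all_order all_algebra.
From mathcomp Require Import boolp classical_sets reals topology normedtype.
From mathcomp Require Import sequences.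
From mathcomp Require Import derive realfun trigo zify ring lra.
Import Order.TTheory GRing.Theory Num.Theory.
Import numFieldNormedType.Exports.
Local Open Scope classical_set_scope.
Local Open Scope ring_scope.

(** By the criterion of Weyl ([weyl_criterion]) it suffices that the means of
    cos (2 pi (k x_n + s)) tend to 0 for k >= 1.  The sequence k x_n + s satisfies
    the same hypotheses as x_n, and the cosine is even, so the task is to show
    that the sum of c_n = cos (2 pi x_n) over n <= N is o(N) when
    u_n = Delta^2 x_n is weakly decreasing.

    Let s_n = sin (2 pi x_n), and let f_n be the fractional part of Delta x_n.
    Then c_n + c_(n+1) = cot (pi f_n) (s_(n+1) - s_n), so a summation by parts
    bounds the sum by the total variation of cot (pi f_n).  Since u_n >= 0, f_n
    moves to the right, and the cotangent decreases, except when Delta x_n crosses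
    an integer; its variation is thus controlled by its size, once it is truncated
    near the integers.  Steps with f_n within about 1/T_n of an integer are lost by a
    truncation at height about T_n.  They are counted by adding to the cotangent two
    ramps of slope T_n^2 there: when T_n^2 u_n >= 1, each lost step that
    crosses no integer makes the resulting function [potential] drop by at least 1,
    so these steps are paid by the same monotone quantity ([potential_step]).  What
    does not telescope is the cost, of order T_n, of each crossing of an integer; a
    second summation by parts turns the sum of these costs into a sum of T_n u_n,
    up to O(T_N) ([cos_sum_bound]).

    The truncation level T_n = max (2, max_(j <= n) u_j^(-1/2)) depends on n.  Weak
    monotonicity with constant K gives T_n <= 2 + sqrt (K / u_n), hence T_n u_n -> 0
    because u_n -> 0, and T_N / N -> 0 because N^2 u_N tends to infinity; both
    error terms are o(N) ([mean1_cos_cvg0_pos]).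

    For the criterion, only lower bounds for the frequencies of intervals are
    needed ([freq_ge]): applied to the two complementary intervals they yield the
    upper bound.  The lower bound compares the indicator function with a sum of
    translates of the Fejer kernel along a grid, which is at most 1 everywhere
    and is small outside the interval ([fejer_window]). *)

(** * Trigonometric estimates *)

Lemma le_sin_id {R : realType} (y : R) : 0 <= y -> sin y <= y.
Proof.
move=> y0; have [c _ ] := @MVT_segment R sin cos 0 y y0 (fun x _ => is_derive_sin x)
  (continuous_subspaceT (@continuous_sin R)).
rewrite sin0 !subr0 => ->.
by have := cos_le1 c; nra.
Qed.

Lemma sin_piMB {R : realType} (f : R) : sin (pi * (1 - f)) = sin (pi * f).
Proof. by rewrite mulrBr mulr1 sinB sinpi cospi mul0r mulN1r opprK add0r. Qed.

Lemma sin_piM_le {R : realType} (f : R) : 0 <= f -> sin (pi * f) <= 4 * f.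
Proof.
move=> f0; have := @pihalf_lt2 R; have := @pi_gt0 R => p0 p2.
by apply: le_trans (le_sin_id _ _) _; nra.
Qed.

(** A weak form of the Jordan inequality; splitting at f = 1/4 keeps the cosine in the
    mean value theorem at least 1/2. *)
Lemma le_sin_piM {R : realType} (f : R) : 0 <= f <= 1/2 -> f <= sin (pi * f).
Proof.
move=> /andP[f0 f1]; have p2 := @pi_ge2 R.
have c4 : 1/2 <= cos (pi / 4 : R) /\ 1/2 <= sin (pi / 4 : R).
  have e : (pi / 4 : R) *+ 2 = pi / 2 by rewrite -mulr_natr; field.
  have := @cos_mulr2n R (pi / 4); rewrite e cos_pihalf => h.
  have h2 := cos2Dsin2 (pi / 4 : R).
  have s0 : 0 <= sin (pi / 4 : R) by apply: sin_ge0_pi; lra.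
  have c0 : 0 <= cos (pi / 4 : R) by apply: cos_ge0_pihalf; lra.
  by split; nra.
have [f4|f4] := leP f (1/4).
  have pf : 0 <= pi * f by nra.
  have [c] := @MVT_segment R sin cos 0 (pi * f) pf (fun x _ => is_derive_sin x)
    (continuous_subspaceT (@continuous_sin R)).
  rewrite in_itv /= sin0 !subr0 => /andP[c0 cf] ->.
  have : 1/2 <= cos c.
    apply: le_trans c4.1 _.
    have [->//|ne] := eqVneq c (pi / 4).
    have c4' : c <= pi / 4 by nra.
    rewrite ltW // ltr_cos ?in_itv /=; first by rewrite lt_neqAle ne.
    - by apply/andP; split; nra.
    - by apply/andP; split; lra.
  by nra.
apply: le_trans (f1) _; apply: le_trans c4.2 _.
have pf1 : pi / 4 < pi * f by nra.
have pf2 : pi * f <= pi / 2 by nra.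
by rewrite ltW // ltr_sin ?in_itv //=; apply/andP; split; lra.
Qed.

Lemma cos2piDint {R : realType} (k : int) (t : R) :
  cos (2 * pi * (t + k%:~R)) = cos (2 * pi * t).
Proof.
rewrite mulrDr; case: (intP k) => [|n|n]; first by rewrite mulr0z mulr0 addr0.
- rewrite -[RHS](periodicn (@cosD2pi R) n.+1); congr cos.
  by rewrite -mulrnA -[pi *+ _]mulr_natl natrM -pmulrn; ring.
- rewrite -[LHS](periodicn (@cosD2pi R) n.+1); congr cos.
  by rewrite mulrNz -mulrnA -[pi *+ _]mulr_natl natrM -pmulrn; ring.
Qed.

Lemma sin2piDint {R : realType} (k : int) (t : R) :
  sin (2 * pi * (t + k%:~R)) = sin (2 * pi * t).
Proof.
rewrite mulrDr; case: (intP k) => [|n|n]; first by rewrite mulr0z mulr0 addr0.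
- rewrite -[RHS](periodicn (@sinD2pi R) n.+1); congr sin.
  by rewrite -mulrnA -[pi *+ _]mulr_natl natrM -pmulrn; ring.
- rewrite -[LHS](periodicn (@sinD2pi R) n.+1); congr sin.
  by rewrite mulrNz -mulrnA -[pi *+ _]mulr_natl natrM -pmulrn; ring.
Qed.

(** The identity c + c' = cot (z - y) (s' - s) without the division, so that it
    also covers sin (z - y) = 0. *)
Lemma cosD_sinB {R : realType} (y z : R) :
  (cos (2 * y) + cos (2 * z)) * sin (z - y)
  = cos (z - y) * (sin (2 * z) - sin (2 * y)).
Proof.
rewrite !mulr_natl !cos_mulr2n !sin_mulr2n sinB cosB.
have := sin2cos2 y; have := sin2cos2 z; move: (cos y) (sin y) (cos z) (sin z).
move=> a b c d hz hy; ring: hz hy.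
Qed.

Lemma normr_sinB_le {R : realType} (y z : R) :
  `|sin (2 * z) - sin (2 * y)| <= 2 * `|sin (z - y)|.
Proof.
have -> : sin (2 * z) - sin (2 * y) = 2 * cos (z + y) * sin (z - y).
  have -> : 2 * z = (z + y) + (z - y) by ring.
  have -> : 2 * y = (z + y) - (z - y) by ring.
  by rewrite sinD (sinB (z + y) (z - y)); ring.
by rewrite normrM ler_wpM2r// normrM ger0_norm// ler_piMr// cos_max.
Qed.

(** * The truncated cotangent with ramps *)

(** The cotangent of pi f truncated at height 2 T.  Bounding the sine from below,
    instead of clamping the quotient, makes the value at f = 0 the right one. *)
Definition cot_trunc {R : realType} (T f : R) : R :=
  cos (pi * f) / Num.max (sin (pi * f)) (2 * T)^-1.

Definition ramp {R : realType} (T f : R) : R := Num.max 0 (T - T ^+ 2 * f).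

(** For T >= 2 this is cot (pi f) for 1/T <= f <= 1 - 1/T.  The ramps make it strictly
    decreasing, with slope at most - T^2, where the cotangent is truncated; they
    are continuous in T, so that a change of level costs only O(T' - T). *)
Definition potential {R : realType} (T f : R) : R :=
  cot_trunc T f + ramp T f - ramp T (1 - f).

Lemma le_ramp {R : realType} (T f g : R) : f <= g -> ramp T g <= ramp T f.
Proof. by move=> fg; rewrite /ramp ge_max le_max lexx /= le_max lerB ?orbT // ler_wpM2l ?sqr_ge0. Qed.

Lemma ramp_bound {R : realType} (T f : R) :
  0 <= T -> 0 <= f -> 0 <= ramp T f <= T.
Proof. by move=> T0 f0; rewrite /ramp le_max lexx /= ge_max T0 /=; nra. Qed.

Lemma ramp_lipschitz {R : realType} (T T' f : R) :
  0 < T -> T <= T' -> 0 <= f -> `|ramp T' f - ramp T f| <= T' - T.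
Proof.
move=> T0 TT f0; rewrite /ramp ler_norml.
have -> : T - T ^+ 2 * f = T * (1 - T * f) by ring.
have -> : T' - T' ^+ 2 * f = T' * (1 - T' * f) by ring.
have pq : T * f <= T' * f by rewrite ler_wpM2r.
have p0 : 0 <= T * f by rewrite mulr_ge0 // ltW.
have T0' : 0 < T' by lra.
have [p1|p1] := leP 1 (T * f); have [q1|q1] := leP 1 (T' * f); try lra.
- by rewrite !max_l ?subrr; [apply/andP; split; lra|nra|nra].
- rewrite (@max_l _ _ 0 (T' * _)) ?(@max_r _ _ 0 (T * _)); [|nra|nra].
  have : T <= T' * (T * f) by nra.
  by move=> h; apply/andP; split; nra.
- rewrite !max_r; [|nra|nra].
  have -> : T' * (1 - T' * f) - T * (1 - T * f) = (T' - T) * (1 - T * f - T' * f) by ring.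
  by apply/andP; split; nra.
Qed.

(** After clearing denominators: where both sines exceed the truncation level the
    inequality is sin (pi g - pi f) >= 0, where both are below it the cosine
    decreases, and the mixed cases follow from the signs of the cosines. *)
Lemma cot_trunc_homo {R : realType} (T f g : R) : 0 < T -> 0 <= f -> f <= g -> g <= 1 ->
  cot_trunc T g <= cot_trunc T f.
Proof.
move=> T0 f0 fg g1; have p0 := @pi_gt0 R; rewrite /cot_trunc.
set a := pi * f; set b := pi * g; set d := (2 * T)^-1.
have d0 : 0 < d by rewrite invr_gt0; lra.
have a0 : 0 <= a by rewrite /a; nra.
have ab : a <= b by rewrite /a /b; nra.
have b1 : b <= pi by rewrite /b; nra.
have sa : 0 <= sin a by apply: sin_ge0_pi; lra.
have sb : 0 <= sin b by apply: sin_ge0_pi; lra.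
have cab : cos b <= cos a.
  have [->//|ne] := eqVneq a b.
  rewrite ltW // ltr_cos ?in_itv /=; first by rewrite lt_neqAle ne.
  - by apply/andP; split; lra.
  - by apply/andP; split; lra.
have sba : 0 <= sin b * cos a - cos b * sin a.
  by rewrite -sinB; apply: sin_ge0_pi; lra.
have ca : cos a <= 0 -> sin b <= sin a.
  move=> h; have h2 := cos2Dsin2 a; have h3 := cos2Dsin2 b; nra.
have cb : 0 <= cos b -> sin a <= sin b.
  move=> h; have h2 := cos2Dsin2 a; have h3 := cos2Dsin2 b; nra.
rewrite ler_pdivrMr ?lt_max ?d0 ?orbT // mulrAC ler_pdivlMr ?lt_max ?d0 ?orbT //.
case: (leP (sin a)) => ha; case: (leP (sin b)) => hb; [nra| | |nra].
- have [c0|c0] := leP 0 (cos b); first by nra.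
  by have [c1|c1] := leP 0 (cos a); nra.
- have [c0|c0] := leP (cos a) 0; first by nra.
  by have [c1|c1] := leP 0 (cos b); nra.
Qed.

Lemma cot_trunc_bound {R : realType} (T f : R) : 0 < T -> `|cot_trunc T f| <= 2 * T.
Proof.
move=> T0; rewrite /cot_trunc; set m := Num.max _ _.
have d0 : 0 < (2 * T)^-1 by rewrite invr_gt0; lra.
have m0 : (2 * T)^-1 <= m by rewrite /m le_max lexx orbT.
have mp : 0 < m by lra.
rewrite normrM normfV (gtr0_norm mp) ler_pdivrMr //.
apply: le_trans (cos_max _) _.
rewrite -[leLHS](@mulfV _ (2 * T)) ?gt_eqF//; last by lra.
by rewrite ler_wpM2l//; lra.
Qed.

Lemma cot_trunc_lipschitz {R : realType} (T T' f : R) : 0 < T -> T <= T' ->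
  `|cot_trunc T' f - cot_trunc T f| <= 2 * (T' - T).
Proof.
move=> T0 TT; rewrite /cot_trunc -mulrBr normrM.
set s := sin _.
suff h : `|(Num.max s (2 * T')^-1)^-1 - (Num.max s (2 * T)^-1)^-1| <= 2 * (T' - T).
  by apply: le_trans h; rewrite ler_piMl ?normr_ge0 ?cos_max.
have d0 : 0 < (2 * T)^-1 by rewrite invr_gt0; lra.
have d0' : 0 < (2 * T')^-1 by rewrite invr_gt0; lra.
have dd : (2 * T')^-1 <= (2 * T)^-1 by rewrite lef_pV2 ?posrE; lra.
have inv (y : R) : 0 < y -> (2 * T')^-1 <= y -> y <= (2 * T)^-1 ->
    2 * T <= y^-1 <= 2 * T'.
  move=> y0 y1 y2; rewrite -[2 * T]invrK -[2 * T']invrK !lef_pV2 ?posrE //.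
  by rewrite y1 y2.
rewrite ler_norml.
case: (leP s) => h; case: (leP s) => h'; rewrite ?invrK; try lra.
by have := inv s; lra.
Qed.

Lemma potential_bound {R : realType} (T f : R) : 0 < T -> 0 <= f <= 1 ->
  `|potential T f| <= 3 * T.
Proof.
move=> T0 /andP[f0 f1]; have := cot_trunc_bound T f T0.
have := @ramp_bound _ T f (ltW T0) f0.
have f1' : 0 <= 1 - f by lra.
have := @ramp_bound _ T (1 - f) (ltW T0) f1'.
rewrite /potential !ler_norml => /andP[? ?] /andP[? ?] /andP[? ?].
by apply/andP; split; lra.
Qed.

Lemma potential_lipschitz {R : realType} (T T' f : R) : 0 < T -> T <= T' -> 0 <= f <= 1 ->
  `|potential T' f - potential T f| <= 4 * (T' - T).
Proof.
move=> T0 TT /andP[f0 f1]; have := @cot_trunc_lipschitz _ T T' f T0 TT.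
have := @ramp_lipschitz _ T T' f T0 TT f0.
have f1' : 0 <= 1 - f by lra.
have := @ramp_lipschitz _ T T' (1 - f) T0 TT f1'.
rewrite /potential !ler_norml => /andP[? ?] /andP[? ?] /andP[? ?].
by apply/andP; split; lra.
Qed.

(** The error is C times 1 - sin / max (sin, 1/(2T)), a factor that lies in [0, 1]
    and vanishes where nothing is truncated. *)
Lemma cot_trunc_error {R : realType} (T f C S : R) :
  0 < T -> 0 <= f <= 1 -> `|C| <= 2 ->
  C * sin (pi * f) = cos (pi * f) * S ->
  `|C - cot_trunc T f * S| <= 2 /\
  ((2 * T)^-1 <= sin (pi * f) -> C = cot_trunc T f * S).
Proof.
move=> T0 /andP[f0 f1] C2 CS; have p0 := @pi_gt0 R.
have s0 : 0 <= sin (pi * f) by apply: sin_ge0_pi; apply/andP; split; nra.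
rewrite /cot_trunc mulrAC -CS; set m := Num.max _ _.
have d0 : 0 < (2 * T)^-1 by rewrite invr_gt0; lra.
have m0 : 0 < m by rewrite /m lt_max d0 orbT.
split; last by move=> h; rewrite /m max_l // mulfK // gt_eqF //; lra.
rewrite -mulrA -{1}[C]mulr1 -mulrBr normrM; apply: le_trans C2.
rewrite ler_piMr // ler_norml.
have h0 : 0 <= sin (pi * f) / m by rewrite divr_ge0 // ltW.
have h1 : sin (pi * f) / m <= 1 by rewrite ler_pdivrMr // mul1r /m le_max lexx.
by apply/andP; split; lra.
Qed.

(** The ramp is supported in f <= 1/T, where S = O(1/T); this compensates the height
    T of the ramp. *)
Lemma ramp_error {R : realType} (T f S : R) :
  1 <= T -> 0 <= f -> `|S| <= 8 * f ->
  `|ramp T f * S| <= 8 * Num.min 1 (ramp T f).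
Proof.
move=> T1 f0 Sf; have T0 : 0 <= T by lra.
have /andP[r0 rT] := ramp_bound T f T0 f0.
rewrite normrM (ger0_norm r0).
have [Tf|Tf] := leP (T * f) 1; last first.
  have -> : ramp T f = 0 by rewrite /ramp max_l //; nra.
  by rewrite mul0r minEle ler10 mulr0.
have h : ramp T f * `|S| <= ramp T f * (8 * f) by rewrite ler_wpM2l.
have h2 : ramp T f * f <= T * f by rewrite ler_wpM2r.
have h3 : f <= T * f by rewrite ler_peMl.
by have [c|c] := leP 1 (ramp T f); nra.
Qed.

Lemma ramp_gain {R : realType} (T f u : R) : 0 <= T -> 0 <= f -> 1 <= T ^+ 2 * u ->
  Num.min 1 (ramp T f) <= ramp T f - ramp T (f + u).
Proof.
move=> T0 f0 Tu; rewrite /ramp mulrDr.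
case: (leP 0 (T - T ^+ 2 * f)) => h1; case: (leP 0 (T - (T ^+ 2 * f + T ^+ 2 * u))) => h2.
- by rewrite ge_min; apply/orP; left; lra.
- by rewrite subr0 ge_min lexx orbT.
- by lra.
- by rewrite subr0 ge_min lexx orbT.
Qed.

(** Where the sine is below the truncation level, f is so close to 0 that the ramp
    is at least T/2 >= 1. *)
Lemma min1_ramp_eq1 {R : realType} (T y : R) : 2 <= T -> 0 <= y <= 1/2 ->
  sin (pi * y) < (2 * T)^-1 -> Num.min 1 (ramp T y) = 1.
Proof.
move=> T2 y01 sy; have yT := le_lt_trans (le_sin_piM y y01) sy.
apply/min_idPl; rewrite /ramp le_max; apply/orP; right.
have : T * y <= 1 / 2.
  have -> : 1 / 2 = T * (2 * T)^-1 :> R by field; lra.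
  by rewrite ler_wpM2l; lra.
by nra.
Qed.

(** The key step.  Here f and g are consecutive fractional parts of Delta x_n, u is
    the second difference and r the number of integers crossed; C and S stand for
    c_n + c_(n+1) and s_(n+1) - s_n.  If no integer is crossed, every part of the
    error is at most a constant times the drop of a ramp.  Otherwise the error is bounded and
    the potential rises by at most 6 T, which the term in r covers. *)
Lemma potential_step {R : realType} (T u f g r C S : R) :
  2 <= T -> 1 <= T ^+ 2 * u -> 0 <= f < 1 -> 0 <= g < 1 -> f + u = g + r ->
  (r = 0 \/ 1 <= r) -> `|C| <= 2 -> `|S| <= 2 * sin (pi * f) ->
  C * sin (pi * f) = cos (pi * f) * S ->
  `|C - potential T f * S| <= 10 * (potential T f - potential T g + 7 * T * r).
Proof.
move=> T2 Tu /andP[f0 f1] /andP[g0 g1] fg hr C2 Ss CS.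
have T0 : 0 < T by lra.
have T1 : 1 <= T by lra.
have u0 : 0 <= u by nra.
have fle : 0 <= f <= 1 by apply/andP; split; lra.
have [e1 e2] := cot_trunc_error T f C S T0 fle C2 CS.
have f0' : 0 <= 1 - f by lra.
have Sf : `|S| <= 8 * f by have := sin_piM_le f f0; lra.
have Sf' : `|S| <= 8 * (1 - f).
  by have := sin_piM_le (1 - f) f0'; rewrite sin_piMB; lra.
have E1 := ramp_error T f S T1 f0 Sf.
have E2 := ramp_error T (1 - f) S T1 f0' Sf'.
have E : `|C - potential T f * S| <= `|C - cot_trunc T f * S| +
    8 * Num.min 1 (ramp T f) + 8 * Num.min 1 (ramp T (1 - f)).
  have -> : C - potential T f * S = C - cot_trunc T f * S - ramp T f * S
      + ramp T (1 - f) * S by rewrite /potential; ring.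
  apply: le_trans (ler_normD _ _) (lerD _ E2).
  by apply: le_trans (ler_normB _ _) (lerD _ E1).
apply: le_trans E _.
have [rf|rf] : r = 0 \/ 1 <= r by [].
  have gE : g = f + u by lra.
  have G1 := ramp_gain T f u (ltW T0) f0 Tu; rewrite -gE in G1.
  have G2 : Num.min 1 (ramp T (1 - f)) <= ramp T (1 - g) - ramp T (1 - f).
    have [h|h] := leP (ramp T (1 - f)) 0.
      by rewrite ge_min; apply/orP; right; have := le_ramp T (1 - g) (1 - f); lra.
    rewrite ge_min; apply/orP; left; move: h; rewrite /ramp lt_max ltxx /= => h.
    by rewrite !max_r; nra.
  have G0 := @cot_trunc_homo _ T f g T0 f0.
  have {}G0 : cot_trunc T g <= cot_trunc T f by apply: G0; lra.
  have e3 : `|C - cot_trunc T f * S| <=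
      2 * (Num.min 1 (ramp T f) + Num.min 1 (ramp T (1 - f))).
    have m1 : 0 <= Num.min 1 (ramp T f) by rewrite le_min ler01 le_max lexx.
    have m2 : 0 <= Num.min 1 (ramp T (1 - f)) by rewrite le_min ler01 le_max lexx.
    have [h|h] := leP (2 * T)^-1 (sin (pi * f)).
      by rewrite [X in X - _](e2 h) subrr normr0; lra.
    apply: le_trans e1 _.
    have [f2|f2] := leP f (1/2); first by rewrite (min1_ramp_eq1 _ f) //;
      [lra|apply/andP; split; lra].
    by rewrite (min1_ramp_eq1 _ (1 - f)) ?sin_piMB //;
      [lra|apply/andP; split; lra].
  by rewrite /potential rf; lra.
have m1 : Num.min 1 (ramp T f) <= 1 by rewrite ge_min lexx.
have m2 : Num.min 1 (ramp T (1 - f)) <= 1 by rewrite ge_min lexx.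
have gle : 0 <= g <= 1 by apply/andP; split; lra.
have := potential_bound T f T0 fle; have := potential_bound T g T0 gle.
rewrite !ler_norml => /andP[? ?] /andP[? ?].
by nra.
Qed.

(** * The bound for the cosine sum *)

Lemma frac_part_itv {R : realType} (r : R) : 0 <= frac_part r < 1.
Proof.
rewrite /frac_part; have /andP[h1 h2] := floor_itv r.
by rewrite intrD in h2; apply/andP; split; lra.
Qed.

Lemma cos_sum_frac {R : realType} (y z : R) (f := frac_part (z - y))
    (C := cos (2 * pi * y) + cos (2 * pi * z))
    (S := sin (2 * pi * z) - sin (2 * pi * y)) :
  [/\ `|C| <= 2, `|S| <= 2 * sin (pi * f) & C * sin (pi * f) = cos (pi * f) * S].
Proof.
have /andP[f0 f1] : 0 <= f < 1 by exact: frac_part_itv.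
have zE : z = y + f + (Num.floor (z - y))%:~R by rewrite /f /frac_part; ring.
have C2 : `|C| <= 2.
  by apply: le_trans (ler_normD _ _) _; rewrite -[2]/(1 + 1) lerD // cos_max.
have fE : pi * f = pi * (y + f) - pi * y by ring.
have s0 : 0 <= sin (pi * f).
  by have p0 := @pi_gt0 R; apply: sin_ge0_pi; apply/andP; split; nra.
split=> //; rewrite /S /C zE ?cos2piDint sin2piDint -!mulrA.
  by rewrite -(ger0_norm s0) fE normr_sinB_le.
by rewrite fE cosD_sinB.
Qed.

(** Summation by parts with the potential at level T_n.  The proof shows by induction
    that the partial sum differs from v_N s_N by at most
    84 sum (T_n u_n) - 11 v_N - 84 T_N f_N + 132 T_N, where v_n is the potential. *)
Lemma cos_sum_bound {R : realType} (x T : nat -> R) :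
  (forall n, (1 <= n)%N -> 2 <= T n) ->
  (forall n, (1 <= n)%N -> T n <= T n.+1) ->
  (forall n, (1 <= n)%N -> 1 <= T n ^+ 2 * delta2 x n) ->
  forall N, (1 <= N)%N ->
  `|\sum_(1 <= n < N) (cos (2 * pi * x n) + cos (2 * pi * x n.+1))|
  <= 168 * T N + 84 * \sum_(1 <= n < N) T n * delta2 x n.
Proof.
move=> T2 Tmono Tu.
pose f n := frac_part (x n.+1 - x n).
pose v n := potential (T n) (f n).
pose s n := sin (2 * pi * x n).
pose P N := \sum_(1 <= n < N) (cos (2 * pi * x n) + cos (2 * pi * x n.+1)).
pose U N := \sum_(1 <= n < N) T n * delta2 x n.
have f01 n : 0 <= f n <= 1.
  by have /andP[a b] := frac_part_itv (x n.+1 - x n); apply/andP; split; rewrite /f; lra.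
have vT n : (1 <= n)%N -> `|v n| <= 3 * T n.
  by move=> n1; apply: potential_bound => //; have := T2 n n1; lra.
have vsT n : (1 <= n)%N -> `|v n * s n| <= 3 * T n.
  move=> n1; rewrite normrM; apply: le_trans (vT n n1).
  by rewrite ler_piMr // sin_max.
have inv N : (1 <= N)%N ->
    `|P N - v N * s N| <= 84 * U N - 11 * v N - 84 * (T N * f N) + 132 * T N.
  elim: N => [//|[_ _|N IH _]].
    rewrite /P /U !big_nil mulr0 sub0r normrN.
    have := vsT 1%N isT; have := vT 1%N isT; rewrite ler_norml => /andP[? ?] ?.
    have := f01 1%N; have := T2 1%N isT => ? /andP[? ?]; nra.
  have {IH} := IH isT; set n := N.+1 => IH.
  have n1 : (1 <= n)%N by [].
  have [C2 S2 CS] := cos_sum_frac (x n) (x n.+1).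
  rewrite -/(f n) -/(s n) -/(s n.+1) in S2 CS.
  set C := cos (2 * pi * x n) + cos (2 * pi * x n.+1) in C2 CS.
  have Tn := T2 n n1; have TT := Tmono n n1; have Tun := Tu n n1.
  set b := fun n => x n.+1 - x n.
  pose r : R := (Num.floor (b n.+1) - Num.floor (b n))%:~R.
  have uE : delta2 x n = b n.+1 - b n by [].
  have u0 : 0 <= delta2 x n by nra.
  have fr : f n + delta2 x n = f n.+1 + r.
    by rewrite uE /f /frac_part -/(b n) -/(b n.+1) /r intrB; ring.
  have r01 : r = 0 \/ 1 <= r.
    have : Num.floor (b n) <= Num.floor (b n.+1) by apply: le_floor; rewrite /b in uE u0 *; lra.
    rewrite -(subr_ge0 (Num.floor (b n))) /r; case: (_ - _) => [[|k]|k] // _.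
      by left.
    by right; rewrite ler1z.
  have st := potential_step (T n) _ (f n) (f n.+1) r C (s n.+1 - s n) Tn Tun
     (frac_part_itv _) (frac_part_itv _) fr r01 C2 S2 CS.
  have T0 : 0 < T n by lra.
  have lip := potential_lipschitz (T n) (T n.+1) (f n.+1) T0 TT (f01 _).
  rewrite -/(v n) -/(v n.+1) in st lip.
  have -> : P n.+1 = P n + C by rewrite /P big_nat_recr.
  have -> : U n.+1 = U n + T n * delta2 x n by rewrite /U big_nat_recr.
  have -> : P n + C - v n.+1 * s n.+1 =
    (P n - v n * s n) + ((C - v n * (s n.+1 - s n)) + (v n - v n.+1) * s n.+1) by ring.
  apply: le_trans (ler_normD _ _) _.
  have h1 := ler_normD (C - v n * (s n.+1 - s n)) ((v n - v n.+1) * s n.+1).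
  have h2 : `|(v n - v n.+1) * s n.+1| <= `|v n - v n.+1|.
    by rewrite normrM ler_piMr // sin_max.
  set W := potential (T n) (f n.+1) in st lip.
  have G0 : 0 <= v n - W + 7 * T n * r by have := normr_ge0 (C - v n * (s n.+1 - s n)); lra.
  (* The drop of the potential is nonnegative up to the crossing term, so its
     absolute value is the drop itself up to twice that term. *)
  have h3 : `|v n - v n.+1| <= (v n - W + 14 * T n * r) + 4 * (T n.+1 - T n).
    move: lip; rewrite !ler_norml => /andP[l1 l2].
    have : 0 <= T n * r by case: r01 => h; nra.
    by move=> ?; apply/andP; split; lra.
  have W2 : W <= v n.+1 + 4 * (T n.+1 - T n) .
    by move: lip; rewrite ler_norml => /andP[? ?]; lra.
  have W3 : v n.+1 - 4 * (T n.+1 - T n) <= W.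
    by move: lip; rewrite ler_norml => /andP[? ?]; lra.
  (* r = Delta x_(n+1) - f_(n+1) - (Delta x_n - f_n): the cost of a crossing is
     T_n u_n up to an almost telescoping term. *)
  have rE : T n * r = T n * delta2 x n + T n * f n - T n * f n.+1.
    have -> : r = f n + delta2 x n - f n.+1 by lra.
    by ring.
  have /andP[g0 g1] := f01 n.+1.
  have h4 : T n.+1 * f n.+1 - T n * f n.+1 <= T n.+1 - T n.
    by rewrite -mulrBl ler_piMr // subr_ge0.
  lra.
move=> N N1; have := inv N N1; have h1 := vsT N N1; have h2 := vT N N1.
have h3 := ler_normD (P N - v N * s N) (v N * s N); rewrite subrK in h3.
have /andP[g0 g1] := f01 N; have := T2 N N1 => TN.
have h4 : 0 <= T N * f N by rewrite mulr_ge0 //; lra.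
by move: h2; rewrite ler_norml -/(P N) -/(U N) => /andP[? ?]; lra.
Qed.

(** * Means of cosines *)

(** The mean over the indices 1, ..., N; it is 0 for N = 0. *)
Definition mean1 {R : realType} (f : nat -> R) (N : nat) : R :=
  (\sum_(1 <= n < N.+1) f n) / N%:R.

(** For positive u, the least nondecreasing sequence T with T_n >= 2 for all n and
    T_n^2 u_n >= 1 for n >= 1. *)
Fixpoint threshold {R : realType} (u : nat -> R) (n : nat) : R :=
  if n is m.+1 then Num.max (threshold u m) (Num.sqrt (u n))^-1 else 2.

Lemma threshold_ge2 {R : realType} (u : nat -> R) n : 2 <= threshold u n.
Proof. by elim: n => //= n IH; rewrite le_max IH. Qed.

Lemma threshold_sqr {R : realType} (u : nat -> R) n :
  0 < u n.+1 -> 1 <= threshold u n.+1 ^+ 2 * u n.+1.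
Proof.
move=> u0; have s0 : 0 < Num.sqrt (u n.+1) by rewrite sqrtr_gt0.
rewrite -ler_pdivrMr // div1r -{1}(sqr_sqrtr (ltW u0)) -exprVn.
rewrite lerXn2r ?nnegrE ?invr_ge0 ?sqrtr_ge0 //.
  by have := threshold_ge2 u n.+1; lra.
by rewrite /= le_max lexx orbT.
Qed.

Lemma threshold_le {R : realType} (u : nat -> R) (K : R) (N : nat) :
  1 <= K -> 0 < u N ->
  (forall n, (1 <= n <= N)%N -> 0 < u n /\ u N <= K * u n) ->
  threshold u N <= 2 + Num.sqrt K / Num.sqrt (u N).
Proof.
move=> K1 uN uK; have s0 : 0 < Num.sqrt (u N) by rewrite sqrtr_gt0.
have c0 : 0 <= Num.sqrt K / Num.sqrt (u N) by rewrite divr_ge0 // sqrtr_ge0.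
suff h n : (n <= N)%N -> threshold u n <= 2 + Num.sqrt K / Num.sqrt (u N) by exact: h.
elim: n => [_|n IH nN]; first by rewrite /=; lra.
rewrite [threshold _ _]/= ge_max IH 1?ltnW //=.
have [un uKn] := uK n.+1 nN.
apply: (@le_trans _ _ (Num.sqrt K / Num.sqrt (u N))); last by lra.
rewrite ler_pdivlMr // mulrC ler_pdivrMr ?sqrtr_gt0 // -sqrtrM; last by lra.
by apply: ler_wsqrtr.
Qed.

Lemma natV_cvg0 {R : realType} : (N%:R^-1 : R) @[N --> \oo] --> 0.
Proof.
apply/gtr0_cvgV0; last exact: cvgr_idn.
by exists 1%N => // N /= N1; rewrite ltr0n.
Qed.

Lemma weakly_decreasing_gt0 {R : realType} (u : nat -> R) :
  weakly_decreasing u -> `|n%:R ^+ 2 * u n| @[n --> \oo] --> +oo ->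
  forall n, (1 <= n)%N -> 0 < u n.
Proof.
move=> [u0 [K K1 uK]] /cvgryPge /(_ 1) [N _ hN] n n1.
have /= := hN (maxn N n.+1) (leq_maxl _ _).
have nm : (n < maxn N n.+1)%N by rewrite leq_max ltnSn orbT.
move: (maxn N n.+1) nm => m nm h.
have um : 0 < u m.
  rewrite lt_neqAle u0 ?andbT ?(leq_trans _ nm) //.
  by apply/negP => /eqP e; move: h; rewrite -e mulr0 normr0 ler10.
by have := uK n m n1 nm; have := u0 n n1; nra.
Qed.

(** The bound B_N below is [cos_sum_bound] divided by 2 N: its second term comes from
    T_N / N <= 2 / N + sqrt (K / (N^2 u_N)) and its third one is a Cesaro mean of the
    upper bound w_n of T_n u_n. *)
Lemma mean1_cos_cvg0_pos {R : realType} (x : nat -> R) :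
  weakly_decreasing (delta2 x) -> delta2 x n @[n --> \oo] --> (0 : R) ->
  `|n%:R ^+ 2 * delta2 x n| @[n --> \oo] --> +oo ->
  mean1 (fun n => cos (2 * pi * x n)) N @[N --> \oo] --> 0.
Proof.
move=> wd uto0 utoy; have upos := weakly_decreasing_gt0 _ wd utoy.
have [_ [K K1 uK]] := wd.
set u := delta2 x in uto0 utoy upos uK *.
have ubK N n : (1 <= n <= N)%N -> 0 < u n /\ u N <= K * u n.
  move=> /andP[n1 nN]; split; first exact: upos.
  move: nN; rewrite leq_eqVlt => /predU1P[<-|]; last exact: uK.
  by have := upos n n1; nra.
pose T := threshold u.
have TK N : (1 <= N)%N -> T N <= 2 + Num.sqrt K / Num.sqrt (u N).
  by move=> N1; apply: threshold_le => //; [exact: upos|exact: ubK].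
pose w n : R := 2 * u n + Num.sqrt K * Num.sqrt (u n).
have Tw n : (1 <= n)%N -> T n * u n <= w n.
  move=> n1; have un := upos n n1.
  have s0 : 0 < Num.sqrt (u n) by rewrite sqrtr_gt0.
  apply: (@le_trans _ _ ((2 + Num.sqrt K / Num.sqrt (u n)) * u n)).
    by rewrite ler_wpM2r ?TK // ltW.
  rewrite mulrDl lerD2l -{2}(sqr_sqrtr (ltW un)) expr2 mulrA mulfVK // gt_eqF //.
pose M := arithmetic_mean (fun n => w n.+1).
pose B N : R := 169 * N%:R^-1 + 84 * Num.sqrt K * Num.sqrt (N%:R ^+ 2 * u N)^-1
                + 84 * M N.
have su : Num.sqrt (u n) @[n --> \oo] --> (0 : R).
  by rewrite -[0 in X in _ --> X]sqrtr0; apply: continuous_cvg => //; exact: sqrt_continuous.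
have wto0 : w n.+1 @[n --> \oo] --> (0 : R).
  rewrite (cvg_shiftS w).
  have e : 2 * 0 + Num.sqrt K * 0 = 0 :> R by ring.
  have := @cvgD _ _ _ _ _ (fun n => 2 * u n) (fun n => Num.sqrt K * Num.sqrt (u n)) _ _
    (cvgMl_tmp uto0) (cvgMl_tmp su).
  by rewrite e; exact.
have Mto0 : M n @[n --> \oo] --> (0 : R) by exact: cesaro.
have Bto0 : B N @[N --> \oo] --> 0.
  suff sNu : Num.sqrt (N%:R ^+ 2 * u N)^-1 @[N --> \oo] --> (0 : R).
    have e : 169 * 0 + 84 * Num.sqrt K * 0 + 84 * 0 = 0 :> R by ring.
    have := @cvgD _ _ _ _ _ (fun N : nat => 169 * (N%:R^-1 : R) +
        84 * Num.sqrt K * Num.sqrt (N%:R ^+ 2 * u N)^-1) (fun N => 84 * M N) _ _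
      (@cvgD _ _ _ _ _ _ _ _ _ (cvgMl_tmp natV_cvg0) (cvgMl_tmp sNu))
      (cvgMl_tmp Mto0).
    by rewrite e; exact.
  rewrite -[0 in X in _ --> X]sqrtr0; apply: continuous_cvg; first exact: sqrt_continuous.
  apply/gtr0_cvgV0.
    by exists 1%N => // N /= N1; rewrite mulr_gt0 ?upos // exprn_gt0 // ltr0n.
  apply: cvg_trans utoy; apply: near_eq_cvg; exists 1%N => // N /= N1.
  by rewrite ger0_norm // mulr_ge0 ?exprn_ge0 // ltW // upos.
apply: (@squeeze_cvgr _ _ _ _ (fun N => - B N) B) => //; last first.
  by rewrite -oppr0; apply: cvgN.
exists 1%N => // N /= N1; rewrite -ler_norml.
have N0 : 0 < N%:R :> R by rewrite ltr0n.
rewrite /mean1 normrM normfV (gtr0_norm N0) ler_pdivrMr //.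
have Tb : T N <= 2 + Num.sqrt K * Num.sqrt (N%:R ^+ 2 * u N)^-1 * N%:R.
  apply: le_trans (TK N N1) _; rewrite lerD2l -mulrA ler_wpM2l ?sqrtr_ge0 //.
  rewrite sqrtrV ?mulr_ge0 ?sqr_ge0 ?(ltW (upos _ _)) // sqrtrM ?sqr_ge0 //.
  by rewrite sqrtr_sqr (gtr0_norm N0) invfM mulrAC mulVf ?mul1r // gt_eqF.
(* The factor 2 absorbs (N + 1) / N: the arithmetic mean has N + 1 terms. *)
have Sb : \sum_(1 <= n < N) T n * u n <= 2 * M N * N%:R.
  have w0 n : 0 <= w n.+1.
    by rewrite /w addr_ge0 ?mulr_ge0 ?sqrtr_ge0 // ltW // upos.
  have -> : 2 * M N * N%:R = (\sum_(0 <= k < N.+1) w k.+1) * (2 * N%:R / N.+1%:R).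
    by rewrite /M /arithmetic_mean /series /=; ring.
  apply: (@le_trans _ _ (\sum_(0 <= k < N.+1) w k.+1)).
    rewrite -[in leLHS](prednK N1) big_add1 /=.
    rewrite [leRHS](big_cat_nat (n := N.-1)) //=; last first.
      by apply: leq_trans (leq_pred _) (leqnSn _).
    rewrite -[leLHS]addr0 lerD ?sumr_ge0 //.
    by apply: ler_sum => n _; apply: Tw.
  rewrite ler_peMr ?sumr_ge0 // ler_pdivlMr ?ltr0n // mul1r -natrM ler_nat.
  by rewrite mul2n -addnn -addn1 leq_add2l.
have h : `|\sum_(1 <= n < N) (cos (2 * pi * x n) + cos (2 * pi * x n.+1))|
  <= 168 * T N + 84 * \sum_(1 <= n < N) T n * u n.
  apply: cos_sum_bound => //; first by move=> n _; exact: threshold_ge2.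
    by move=> n _; rewrite /T /= le_max lexx.
  by case=> // n _; apply: threshold_sqr; exact: upos.
have e : 2 * \sum_(1 <= n < N.+1) cos (2 * pi * x n) =
   \sum_(1 <= n < N) (cos (2 * pi * x n) + cos (2 * pi * x n.+1)) +
     (cos (2 * pi * x 1%N) + cos (2 * pi * x N)).
  have r1 : \sum_(1 <= n < N.+1) cos (2 * pi * x n) =
    \sum_(1 <= n < N) cos (2 * pi * x n) + cos (2 * pi * x N) by rewrite big_nat_recr.
  have r2 : \sum_(1 <= n < N.+1) cos (2 * pi * x n) =
    cos (2 * pi * x 1%N) + \sum_(1 <= n < N) cos (2 * pi * x n.+1).
    by rewrite big_ltn // big_add1.
  by rewrite big_split /=; lra.
have h1 := cos_max (2 * pi * x 1%N); have h2 := cos_max (2 * pi * x N).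
have h3 := ler_normD (\sum_(1 <= n < N) (cos (2 * pi * x n) + cos (2 * pi * x n.+1)))
   (cos (2 * pi * x 1%N) + cos (2 * pi * x N)).
have h4 := ler_normD (cos (2 * pi * x 1%N)) (cos (2 * pi * x N)).
rewrite -e normrM ger0_norm // in h3.
have -> : B N * N%:R = 169 + 84 * (Num.sqrt K * Num.sqrt (N%:R ^+ 2 * u N)^-1 * N%:R)
   + 42 * (2 * M N * N%:R).
  by rewrite /B; field; rewrite gt_eqF.
by lra.
Qed.

Lemma mean1_cos_cvg0 {R : realType} (x : nat -> R) :
  weakly_monotonic (delta2 x) -> delta2 x n @[n --> \oo] --> (0 : R) ->
  `|n%:R ^+ 2 * delta2 x n| @[n --> \oo] --> +oo ->
  mean1 (fun n => cos (2 * pi * x n)) N @[N --> \oo] --> 0.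
Proof.
move=> [wd|wi] uto0 utoy; first exact: mean1_cos_cvg0_pos.
have dE : delta2 (fun n => - x n) = (fun n => - delta2 x n).
  by apply/funext => n; rewrite /delta2 /telescope /=; ring.
have -> : (fun n => cos (2 * pi * x n)) = (fun n => cos (2 * pi * - x n)).
  by apply/funext => n; rewrite mulrN cosN.
apply: mean1_cos_cvg0_pos; rewrite dE //.
- by rewrite -oppr0; apply: cvgN.
- suff -> : (fun n => `|n%:R ^+ 2 * - delta2 x n|) = (fun n => `|n%:R ^+ 2 * delta2 x n|) by [].
  by apply/funext => n; rewrite mulrN normrN.
Qed.

Lemma weakly_decreasingZ {R : realType} (c : R) (u : nat -> R) :
  0 <= c -> weakly_decreasing u -> weakly_decreasing (fun n => c * u n).
Proof.
move=> c0 [u0 [K K1 uK]]; split; first by move=> n n1; rewrite mulr_ge0 ?u0.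
by exists K => // n j n1 nj; rewrite mulrCA ler_wpM2l ?uK.
Qed.

Lemma mean1_cos_affine_cvg0 {R : realType} (x : nat -> R) (c s : R) : 0 < c ->
  weakly_monotonic (delta2 x) -> delta2 x n @[n --> \oo] --> (0 : R) ->
  `|n%:R ^+ 2 * delta2 x n| @[n --> \oo] --> +oo ->
  mean1 (fun n => cos (2 * pi * (c * x n + s))) N @[N --> \oo] --> 0.
Proof.
move=> c0 wm uto0 utoy.
have dE : delta2 (fun n => c * x n + s) = (fun n => c * delta2 x n).
  by apply/funext => n; rewrite /delta2 /telescope /=; ring.
apply: mean1_cos_cvg0; rewrite dE.
- case: wm => w; [left|right]; first exact: weakly_decreasingZ (ltW c0) w.
  rewrite /weakly_increasing (_ : (fun n => _) = (fun n => c * - delta2 x n)).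
    exact: weakly_decreasingZ (ltW c0) w.
  by apply/funext => n; rewrite mulrN.
- by rewrite -(mulr0 c); apply: cvgMl_tmp.
- apply/cvgryPge => A; move/cvgryPge : utoy => /(_ (A / c)) [N _ hN].
  exists N => // n /hN /=; rewrite mulrCA [in X in _ -> X]normrM (gtr0_norm c0).
  by rewrite ler_pdivrMr // mulrC.
Qed.

(** * The Fejer kernel *)

(** The square of the modulus of (1/M) sum_(h < M) e(h t), that is, the usual Fejer
    kernel divided by M. *)
Definition fejer {R : realType} (M : nat) (t : R) : R :=
  ((\sum_(0 <= h < M) cos (2 * pi * (h%:R * t))) ^+ 2 +
   (\sum_(0 <= h < M) sin (2 * pi * (h%:R * t))) ^+ 2) / M%:R ^+ 2.

Lemma fejer_ge0 {R : realType} M (t : R) : 0 <= fejer M t.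
Proof. by rewrite /fejer divr_ge0 ?addr_ge0 ?sqr_ge0. Qed.

Lemma fejer_periodic {R : realType} M (k : int) (t : R) :
  fejer M (t + k%:~R) = fejer M t.
Proof.
have e h : h%:R * (t + k%:~R) = h%:R * t + (h%:Z * k)%:~R by rewrite mulrDr intrM.
rewrite /fejer; congr ((_ ^+ 2 + _ ^+ 2) / _); apply: eq_bigr => h _; rewrite e.
  exact: cos2piDint.
exact: sin2piDint.
Qed.

Lemma fejerE {R : realType} M (t : R) :
  fejer M t = \sum_(0 <= h < M) \sum_(0 <= l < M)
    cos (2 * pi * (`|h - l|%N%:R * t)) / M%:R ^+ 2.
Proof.
rewrite /fejer.
under [RHS]eq_bigr do rewrite -mulr_suml.
rewrite -mulr_suml; congr (_ / _).
rewrite !expr2 !big_distrl /= -big_split /=; apply: eq_bigr => h _.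
rewrite !big_distrr /= -big_split /=; apply: eq_bigr => l _.
rewrite -cosB; have [lh|/ltnW hl] := leqP l h.
  by rewrite distnEl // natrB //; congr cos; ring.
by rewrite distnEr // natrB // -cosN; congr cos; ring.
Qed.

(** The geometric sum times sin (pi t) telescopes, in real and in imaginary part. *)
Lemma fejer_decay {R : realType} M (t : R) :
  sin (pi * t) ^+ 2 * fejer M t <= 2 / M%:R ^+ 2.
Proof.
have A1 : sin (pi * t) * (\sum_(0 <= h < M) cos (2 * pi * (h%:R * t))) =
    (sin (2 * pi * (M%:R * t) - pi * t) - sin (2 * pi * (0%:R * t) - pi * t)) / 2.
  rewrite big_distrr /= -(telescope_sumr (fun h => sin (2 * pi * (h%:R * t) - pi * t))) //.
  rewrite mulr_suml; apply: eq_bigr => h _.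
  have -> : 2 * pi * (h.+1%:R * t) - pi * t = 2 * pi * (h%:R * t) + pi * t by ring.
  by rewrite sinD sinB; field.
have B1 : sin (pi * t) * (\sum_(0 <= h < M) sin (2 * pi * (h%:R * t))) =
    (- cos (2 * pi * (M%:R * t) - pi * t) - - cos (2 * pi * (0%:R * t) - pi * t)) / 2.
  rewrite big_distrr /= -(telescope_sumr (fun h => - cos (2 * pi * (h%:R * t) - pi * t))) //.
  rewrite mulr_suml; apply: eq_bigr => h _.
  have -> : 2 * pi * (h.+1%:R * t) - pi * t = 2 * pi * (h%:R * t) + pi * t by ring.
  by rewrite cosD cosB; field.
rewrite /fejer mulrA ler_wpM2r ?invr_ge0 ?sqr_ge0 // mulrDr -!exprMn A1 B1.
have sq (a b : R) : `|a| <= 1 -> `|b| <= 1 -> ((a - b) / 2) ^+ 2 <= 1.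
  by rewrite !ler_norml => /andP[? ?] /andP[? ?]; nra.
by rewrite -[2 in leRHS]/(1 + 1) lerD // sq ?normrN ?sin_max ?cos_max.
Qed.

(** Multiplied by 2 sin (pi k / M), which is not 0 for 0 < k < M, the sum
    telescopes over a full period. *)
Lemma sum_cos_grid {R : realType} (M k : nat) (t : R) : (0 < k < M)%N ->
  \sum_(0 <= j < M) cos (2 * pi * (k%:R * (t - j%:R / M%:R))) = 0.
Proof.
move=> /andP[k0 kM]; have M0 : 0 < M%:R :> R by rewrite ltr0n (leq_trans _ kM).
have kr : 0 < k%:R :> R by rewrite ltr0n.
have kMr : k%:R < M%:R :> R by rewrite ltr_nat.
set b : R := pi * (k%:R / M%:R).
have sb : 0 < sin b.
  apply: sin_gt0_pi; rewrite /b; have p0 := @pi_gt0 R.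
  rewrite mulr_gt0 ?divr_gt0 //= gtr_pMr // ltr_pdivrMr // mul1r //.
have {}sb : 2 * sin b != 0 by rewrite gt_eqF // mulr_gt0.
apply: (mulfI sb); rewrite mulr0 big_distrr /=.
pose S j := - sin (2 * pi * (k%:R * (t - j%:R / M%:R)) + b).
rewrite (eq_big_nat _ _ (F2 := fun j => S j.+1 - S j)); last first.
  move=> j _; rewrite /S.
  have -> : 2 * pi * (k%:R * (t - j.+1%:R / M%:R)) + b =
     2 * pi * (k%:R * (t - j%:R / M%:R)) - b.
    by rewrite /b -natr1; field; rewrite gt_eqF.
  by rewrite sinB sinD; ring.
rewrite telescope_sumr // /S.
have -> : 2 * pi * (k%:R * (t - 0%:R / M%:R)) + b =
  2 * pi * ((k%:R * (t - M%:R / M%:R) + k%:R / M%:R / 2) + k%:R).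
  by rewrite /b; field; rewrite gt_eqF.
have -> : 2 * pi * (k%:R * (t - M%:R / M%:R)) + b =
  2 * pi * (k%:R * (t - M%:R / M%:R) + k%:R / M%:R / 2).
  by rewrite /b; field; rewrite gt_eqF.
by rewrite -[k%:R in X in _ - - X](_ : k%:~R = k%:R) // sin2piDint; ring.
Qed.

(** Only the diagonal frequencies h = l survive the summation over the grid. *)
Lemma fejer_mass {R : realType} M (t : R) : (0 < M)%N ->
  \sum_(0 <= j < M) fejer M (t - j%:R / M%:R) = 1.
Proof.
move=> M0; have Mr : M%:R != 0 :> R by rewrite pnatr_eq0 -lt0n.
under eq_bigr do rewrite fejerE.
rewrite exchange_big /=.
rewrite (eq_big_nat _ _ (F2 := fun=> M%:R^-1)); last first.
  move=> h /andP[_ hM]; rewrite exchange_big /= big_mkord (bigD1 (Ordinal hM)) //=.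
  rewrite distnn; under eq_bigr do rewrite mul0r mulr0 cos0 mul1r.
  rewrite sumr_const_nat subn0 big1 ?addr0; last first.
    move=> l /eqP lh; rewrite -mulr_suml sum_cos_grid ?mul0r //.
    have lM := ltn_ord l; have hl : h <> l by move=> e; apply: lh; apply/val_inj.
    by lia.
  by rewrite -mulr_natl; field.
rewrite sumr_const_nat subn0. by rewrite -[LHS]mulr_natl mulfV.
Qed.

Lemma le_mean1 {R : realType} (f g : nat -> R) N :
  (forall n, f n <= g n) -> mean1 f N <= mean1 g N.
Proof. by move=> fg; rewrite /mean1 ler_wpM2r ?invr_ge0 // ler_sum. Qed.

Lemma mean1D {R : realType} (f g : nat -> R) N :
  mean1 (fun n => f n + g n) N = mean1 f N + mean1 g N.
Proof. by rewrite /mean1 big_split /= mulrDl. Qed.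

Lemma mean1_cst {R : realType} (c : R) N : (0 < N)%N -> mean1 (fun=> c) N = c.
Proof.
by move=> N0; rewrite /mean1 sumr_const_nat subn1 -[X in X / _]mulr_natr mulfK // pnatr_eq0 -lt0n.
Qed.

Lemma mean1_cst_cvg {R : realType} (c : R) : mean1 (fun=> c) N @[N --> \oo] --> c.
Proof.
apply: (@cvg_trans _ ((fun=> c) @ \oo)); last exact: cvg_cst.
by apply: near_eq_cvg; exists 1%N => // N /= N1; rewrite mean1_cst.
Qed.

Lemma mean1_sum_cvg {R : realType} (I : eqType) (r : seq I) (f : I -> nat -> R) (l : I -> R) :
  (forall i, i \in r -> mean1 (f i) N @[N --> \oo] --> l i) ->
  mean1 (fun n => \sum_(i <- r) f i n) N @[N --> \oo] --> \sum_(i <- r) l i.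
Proof.
move=> fl.
have -> : mean1 (fun n => \sum_(i <- r) f i n) = (fun N => \sum_(i <- r) mean1 (f i) N).
  by apply/funext => N; rewrite /mean1 exchange_big /= mulr_suml.
rewrite big_seq; under eq_fun do rewrite big_seq.
by apply: cvg_big => //; exact: add_continuous.
Qed.

(** The off-diagonal frequencies have mean 0 in the limit, and the diagonal ones
    contribute M / M^2. *)
Lemma mean1_fejer_cvg {R : realType} (x : nat -> R) M (s : R) : (0 < M)%N ->
  (forall k s, (0 < k)%N -> mean1 (fun n => cos (2 * pi * (k%:R * x n + s))) N
     @[N --> \oo] --> (0 : R)) ->
  mean1 (fun n => fejer M (x n - s)) N @[N --> \oo] --> (M%:R^-1 : R).
Proof.
move=> M0 xcos; have Mr : M%:R != 0 :> R by rewrite pnatr_eq0 -lt0n.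
under eq_fun do under eq_fun do rewrite fejerE.
have -> : M%:R^-1 = \sum_(0 <= h < M) \sum_(0 <= l < M) ((h == l)%:R / M%:R ^+ 2 : R).
  rewrite (eq_big_nat _ _ (F2 := fun=> (M%:R ^+ 2)^-1)); last first.
    move=> h /andP[_ hM]; rewrite big_mkord (bigD1 (Ordinal hM)) //= eqxx mul1r.
    rewrite big1 ?addr0 // => l /eqP lh; case: eqP => [e|]; last by rewrite mul0r.
    by case: lh; apply/val_inj.
  by rewrite sumr_const_nat subn0 -[RHS]mulr_natl; field.
apply: mean1_sum_cvg => h _; apply: mean1_sum_cvg => l _.
case: eqP => [->|hl].
  rewrite distnn; under eq_fun do under eq_fun do rewrite mul0r mulr0 cos0.
  exact: mean1_cst_cvg.
have -> : mean1 (fun n => cos (2 * pi * (`|h - l|%N%:R * (x n - s))) / M%:R ^+ 2) =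
  (fun N => mean1 (fun n => cos (2 * pi * (`|h - l|%N%:R * x n + - (`|h - l|%N%:R * s)))) N / M%:R ^+ 2).
  apply/funext => N; rewrite /mean1 mulrAC; congr (_ / _).
  by rewrite mulr_suml; apply: eq_bigr => n _; rewrite mulrBr.
by apply: cvgMr_tmp; apply: xcos; lia.
Qed.

(** * The criterion of Weyl *)

Lemma dist_sin_piM {R : realType} (d y : R) :
  d <= `|y| <= 1 - d -> 0 <= d -> d ^+ 2 <= sin (pi * y) ^+ 2.
Proof.
move=> /andP[dy yd] d0.
have -> : sin (pi * y) ^+ 2 = sin (pi * `|y|) ^+ 2.
  by case: (ger0P y) => // _; rewrite mulrN sinN sqrrN.
move: `|y| dy yd => z dz zd.
suff h : d <= sin (pi * z) by rewrite lerXn2r ?nnegrE // (le_trans d0 h).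
have [z2|z2] := leP z (1/2).
  by apply: le_trans (dz) _; apply: le_sin_piM; apply/andP; split; lra.
rewrite -sin_piMB; apply: (@le_trans _ _ (1 - z)); first by lra.
by apply: le_sin_piM; apply/andP; split; lra.
Qed.

Definition freq {R : realType} (x : nat -> R) (a b : R) : nat -> R :=
  mean1 (fun n => (a <= frac_part (x n) < b)%R%:R).

(** The left side is a part of the full grid sum, which is 1 by [fejer_mass]; and
    if the fractional part of t is outside [a, b), each of its at most M terms is at
    most 2 / (M d)^2 by [fejer_decay]. *)
Lemma fejer_window {R : realType} (M j1 j2 : nat) (a b d t : R) :
  (0 < M)%N -> 0 < d -> 0 <= a -> b <= 1 -> (j2 <= M)%N ->
  (forall j, (j1 <= j < j2)%N -> a + d <= j%:R / M%:R <= b - d) ->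
  \sum_(j1 <= j < j2) fejer M (t - j%:R / M%:R) <=
  (a <= frac_part t < b)%R%:R + 2 / (M%:R * d ^+ 2).
Proof.
move=> M0 d0 a0 b1 j2M jab; have Mr : 0 < M%:R :> R by rewrite ltr0n.
have rhs0 : 0 <= 2 / (M%:R * d ^+ 2) by rewrite divr_ge0 // mulr_ge0 ?sqr_ge0 // ltW.
have /andP[y0 y1] := frac_part_itv t.
have tE j : fejer M (t - j%:R / M%:R) = fejer M (frac_part t - j%:R / M%:R).
  by rewrite -[RHS](fejer_periodic _ (Num.floor t)); congr fejer; rewrite /frac_part; ring.
have [ab|nab] := boolP (a <= frac_part t < b).
  rewrite -[leLHS]addr0 lerD // -[leRHS](fejer_mass M t M0).
  have [j12|j12] := leqP j1 j2; last first.
    by rewrite big_geq ?sumr_ge0 // 1?ltnW // => j _; exact: fejer_ge0.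
  rewrite [leRHS](big_cat_nat (n := j1)) ?(leq_trans j12) //=.
  rewrite [X in _ <= _ + X](big_cat_nat (n := j2)) //=.
  have S0 m n : 0 <= \sum_(m <= i < n) fejer M (t - i%:R / M%:R).
    by apply: sumr_ge0 => i _; exact: fejer_ge0.
  by have := S0 0%N j1; have := S0 j2 M; lra.
rewrite add0r; set q := 2 / (M%:R ^+ 2 * d ^+ 2).
have q0 : 0 <= q by rewrite divr_ge0 // mulr_ge0 ?sqr_ge0.
apply: (@le_trans _ _ (\sum_(j1 <= j < j2) q)).
  apply: ler_sum_nat => j j12; rewrite tE.
  have /andP[s1 s2] := jab j j12.
  set y := frac_part t - j%:R / M%:R.
  have dy : d <= `|y| <= 1 - d.
    move: nab; rewrite negb_and -ltNge -leNgt => /orP[h|h].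
      by rewrite ltr0_norm /y; [apply/andP; split; lra|lra].
    by rewrite gtr0_norm /y; [apply/andP; split; lra|lra].
  have sd := dist_sin_piM d y dy (ltW d0).
  rewrite /q invfM mulrA ler_pdivlMr ?exprn_gt0 // mulrC.
  apply: le_trans (fejer_decay M y).
  by rewrite ler_wpM2r ?fejer_ge0.
rewrite sumr_const_nat -[leLHS]mulr_natl.
have -> : 2 / (M%:R * d ^+ 2) = M%:R * q.
  by rewrite /q; field; rewrite !gt_eqF.
by rewrite ler_wpM2r // ler_nat (leq_trans (leq_subr _ _)).
Qed.

(** Average [fejer_window] over t = x_n: by [mean1_fejer_cvg] the mean of the left side
    tends to the proportion of grid points used, which is about b - a - 2 d. *)
Lemma freq_ge {R : realType} (x : nat -> R) (a b e : R) :
  (forall k s, (0 < k)%N -> mean1 (fun n => cos (2 * pi * (k%:R * x n + s))) N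
     @[N --> \oo] --> (0 : R)) ->
  0 <= a -> b <= 1 -> 0 < e -> \forall N \near \oo, b - a - e <= freq x a b N.
Proof.
move=> xcos a0 b1 e0; pose d := e / 8.
have d0 : 0 < d by rewrite /d; lra.
have [M [M0 M1 M2]] : exists M : nat,
    [/\ (0 < M)%N, 2 / M%:R <= e / 4 & 2 / (M%:R * d ^+ 2) <= e / 4 :> R].
  have c1 : 0 <= 8 / e by rewrite divr_ge0 // ltW.
  have c2 : 0 <= 8 / (e * d ^+ 2) by rewrite divr_ge0 // mulr_ge0 ?sqr_ge0 // ltW.
  have := truncnS_gt (8 / e + 8 / (e * d ^+ 2)); set M := (Num.truncn _).+1 => hM.
  have Mr : 0 < M%:R :> R by rewrite ltr0n.
  exists M; split=> //.
    have : 8 / e <= M%:R by lra.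
    by rewrite !ler_pdivrMr //; lra.
  have : 8 / (e * d ^+ 2) <= M%:R by lra.
  have d2 : 0 < d ^+ 2 by rewrite exprn_gt0.
  by rewrite !ler_pdivrMr ?mulr_gt0 //; nra.
have Mr : 0 < M%:R :> R by rewrite ltr0n.
pose j1 := (Num.truncn (M%:R * (a + d))).+1.
pose j2 := Num.truncn (M%:R * (b - d)).
have [bd|bd] := ltP (b - d) 0.
  apply: nearW => N; apply: (@le_trans _ _ 0); first by rewrite /d in bd; lra.
  by rewrite /freq /mean1 divr_ge0 // sumr_ge0.
have ad0 : 0 <= M%:R * (a + d) by rewrite mulr_ge0 ?(ltW Mr) //; lra.
have bd0 : 0 <= M%:R * (b - d) by rewrite mulr_ge0 ?(ltW Mr).
have /andP[j1a j1b] := truncn_itv ad0.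
have /andP[j2a j2b] := truncn_itv bd0.
rewrite -/j1 -/j2 in j1b j2a j2b.
have jab j : (j1 <= j < j2)%N -> a + d <= j%:R / M%:R <= b - d.
  move=> /andP[h1 h2]; rewrite ler_pdivlMr // ler_pdivrMr //.
  have : (j1%:R : R) <= j%:R by rewrite ler_nat.
  have : (j%:R : R) < j2%:R by rewrite ltr_nat.
  by move=> ? ?; apply/andP; split; lra.
have j2M : (j2 <= M)%N by rewrite -(ler_nat R); nra.
have lim : mean1 (fun n => \sum_(j1 <= j < j2) fejer M (x n - j%:R / M%:R)) N
    @[N --> \oo] --> \sum_(j1 <= j < j2) (M%:R^-1 : R).
  by apply: mean1_sum_cvg => j _; exact: mean1_fejer_cvg.
have e4 : 0 < e / 4 by lra.
move/cvgrPdist_le : lim => /(_ _ e4) lim.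
have N1 : \forall N \near \oo, (1 <= N)%N by exists 1%N.
near=> N.
have N0 : (0 < N)%N by near: N.
have h1 : `|\sum_(j1 <= j < j2) (M%:R^-1 : R) -
   mean1 (fun n => \sum_(j1 <= j < j2) fejer M (x n - j%:R / M%:R)) N| <= e / 4.
  by near: N.
have h2 : mean1 (fun n => \sum_(j1 <= j < j2) fejer M (x n - j%:R / M%:R)) N <=
    freq x a b N + 2 / (M%:R * d ^+ 2).
  rewrite -[X in _ + X](mean1_cst _ N N0) -mean1D; apply: le_mean1 => n.
  exact: fejer_window.
have h3 : b - a - 2 * d - 2 / M%:R <= \sum_(j1 <= j < j2) (M%:R^-1 : R).
  rewrite sumr_const_nat -[leRHS]mulr_natl ler_pdivlMr //.
  have -> : (b - a - 2 * d - 2 / M%:R) * M%:R = (b - a - 2 * d) * M%:R - 2.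
    by field; rewrite gt_eqF.
  have : (j2%:R - j1%:R : R) <= (j2 - j1)%:R.
    by rewrite lerBlDr -natrD ler_nat addnC -leq_subLR.
  rewrite /j1 -natr1 in j1a j1b *; rewrite -natr1 in j2b.
  by lra.
move: h1; rewrite ler_norml => /andP[? ?].
by rewrite /d in h3; lra.
Unshelve. all: by end_near.
Qed.

(** Subtracting from 1 the lower bounds for [0, a) and [b, 1) gives the upper bound for
    [a, b). *)
Theorem weyl_criterion {R : realType} (x : nat -> R) :
  (forall k s, (0 < k)%N -> mean1 (fun n => cos (2 * pi * (k%:R * x n + s))) N
     @[N --> \oo] --> (0 : R)) ->
  uniformly_distributed_mod1 x.
Proof.
move=> xcos a b a0 ab b1.
suff : freq x a b N @[N --> \oo] --> b - a.
  rewrite /freq /mean1.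
  under [X in X @ _ --> _ -> _]eq_fun do
    rewrite -natr_sum -big_mkcond sum1_count.
  exact.
apply/cvgrPdist_le => e e0; have e2 : 0 < e / 2 by lra.
have h1 := freq_ge x a b e xcos a0 b1 e0.
have h2 := freq_ge x 0 a _ xcos (lexx _) (ltW (lt_le_trans ab b1)) e2.
have b0 : 0 <= b by lra.
have h3 := freq_ge x b 1 _ xcos b0 (lexx _) e2.
have N1 : \forall N \near \oo, (1 <= N)%N by exists 1%N.
near=> N.
have N0 : (0 < N)%N by near: N.
have l1 : b - a - e <= freq x a b N by near: N.
have l2 : a - 0 - e / 2 <= freq x 0 a N by near: N.
have l3 : 1 - b - e / 2 <= freq x b 1 N by near: N.
have tot : freq x 0 a N + freq x a b N + freq x b 1 N = 1.
  rewrite /freq -!mean1D -[RHS](mean1_cst 1 N N0); congr mean1; apply/funext => n.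
  have /andP[y0 y1] := frac_part_itv (x n).
  rewrite y0 y1 andbT /=.
  have [ya|ya] := ltP (frac_part (x n)) a; have [yb|yb] := ltP (frac_part (x n)) b; 
   rewrite /=; try lra.
by rewrite ler_norml; apply/andP; split; lra.
Unshelve. all: by end_near.
Qed.

(** * Uniform distribution *)

Theorem mainTheorem1 (R : realType) (x : nat -> R)
    (x_wm : weakly_monotonic (delta2 x))
    (x_to0 : delta2 x n @[n --> \oo] --> (0 : R))
    (x_toinf : `|n%:R ^+ 2 * delta2 x n| @[n --> \oo] --> +oo) :
  uniformly_distributed_mod1 x.
Proof.
apply: weyl_criterion => k s k0.
by apply: mean1_cos_affine_cvg0 => //; rewrite ltr0n.
Qed.
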